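(* Let $f:\Gamma\to\mathbb{R}$ be a smooth symmetric function on the cone $\Gamma\subsetneq\mathbb{R}^n$. Assume that $f$ is concave in $\Gamma$ and $\lim_{t\to+\infty}f(t\lambda)>-\infty$ for every $\lambda\in\Gamma_n$. Let $\mathcal{S}$ be a symmetric subset of $\{\lambda\in\Gamma:f(\lambda)<\sup_\Gamma f\}$ with $\partial\Gamma^\sigma\subseteq\mathcal{S}$ for some $\sup_{\partial\Gamma}f<\sigma<\sup_\Gamma f$. Then $f_i\ge 0$ in $\Gamma$ for all $1\le i\le n$, and there exists a uniform positive constant $\vartheta_{\Gamma_{\mathcal{G}}^{f}}$ depending only on $\Gamma_{\mathcal{G}}^{f}$ such that for any $\lambda\in\mathcal{S}$ with $\lambda_1\le\cdots\le\lambda_n$, $$f_i(\lambda)\ge\vartheta_{\Gamma_{\mathcal{G}}^{f}}\sum_{j=1}^n f_j(\lambda)>0,\qquad\forall\,1\le i\le 1+\kappa_{\Gamma_{\mathcal{G}}^{f}} .$$ Moreover, the statement of $(1+\kappa_{\Gamma_{\mathcal{G}}^{f}})$-uniform ellipticity cannot be further improved: if $f$ is of $\mathrm{m}$-uniform ellipticity in $\mathcal{S}$ for some integer $1\le \mathrm{m}\le n$, then $\mathrm{m}\le 1+\kappa_{\Gamma_{\mathcal{G}}^{f}}$.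
   Context: $\Gamma\subsetneq\mathbb{R}^n$ is an open convex cone with vertex at the origin, invariant under permutations of coordinates, with nonempty boundary $\partial\Gamma$, and containing $\Gamma_n=\{\lambda\in\mathbb{R}^n:\text{each }\lambda_i>0\}$. A subset is symmetric if it is invariant under permutations of coordinates. Write $f_i=\partial f/\partial\lambda_i$. $\sup_{\partial\Gamma}f=\sup_{\lambda^0\in\partial\Gamma}\limsup_{\lambda\to\lambda^0}f(\lambda)$ (with $\lambda\in\Gamma$), and $\partial\Gamma^\sigma=\{\lambda\in\Gamma:f(\lambda)=\sigma\}$. $\Gamma_{\mathcal{G}}^{f}=\{\lambda\in\Gamma:\lim_{t\to+\infty}f(t\lambda)>-\infty\}$, with interior $\mathring{\Gamma}_{\mathcal{G}}^{f}$, and $\kappa_{\Gamma_{\mathcal{G}}^{f}}=\max\{k:(\underbrace{0,\dots,0}_{k},\underbrace{1,\dots,1}_{n-k})\in\mathring{\Gamma}_{\mathcal{G}}^{f}\}$. $\mathrm{m}$-uniform ellipticity: for a symmetric subset $\mathcal{S}$ of $\{\lambda\in\Gamma: f(\lambda)<\sup_\Gamma f\}$, $f$ is of $\mathrm{m}$-uniform ellipticity in $\mathcal{S}$ if $f_i\ge0$ in $\Gamma$ for all $i$ and there is a uniform constant $\vartheta>0$ such that for any $\lambda\in\mathcal{S}$ with $f_1(\lambda)\ge\cdots\ge f_n(\lambda)$ one has $f_i(\lambda)\ge\vartheta\sum_{j=1}^n f_j(\lambda)>0$ for all $1\le i\le \mathrm{m}$. *)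

(* Defs.v *)
From HB Require Import structures.
From mathcomp Require Import all_boot all_order all_algebra all_fingroup.
From mathcomp Require Import all_classical all_reals all_analysis.

Set Implicit Arguments.
Unset Strict Implicit.
Unset Printing Implicit Defensive.

Import Order.TTheory GRing.Theory Num.Theory.
Import numFieldNormedType.Exports.

Local Open Scope classical_set_scope.
Local Open Scope ring_scope.

Section Defs.
Variables (R : realType) (n : nat).
Implicit Types (x : 'rV[R]_n) (A Gamma S : set 'rV[R]_n) (f : 'rV[R]_n -> R).

Definition boundary A : set 'rV[R]_n := closure A `\` interior A.

Definition symmetric_set A : Prop :=
  forall (s : 'S_n) x, A x -> A (col_perm s x).

Definition Gamma_pos : set 'rV[R]_n := [set x | forall i, 0 < x 0 i].

Record admissible_cone Gamma : Prop := AdmissibleCone {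
  cone_open : open Gamma;
  cone_convex : convex_set Gamma;
  cone_scale : forall (t : R) x, 0 < t -> Gamma x -> Gamma (t *: x);
  cone_symmetric : symmetric_set Gamma;
  cone_proper : Gamma `<` setT;
  cone_boundary : boundary Gamma !=set0;
  cone_Gamma_pos : Gamma_pos `<=` Gamma }.

(* A function on Gamma is represented by a total function on R^n. Every notion
   below only involves its values on Gamma when Gamma is open. *)

Definition symmetric_on Gamma f : Prop :=
  forall (s : 'S_n) x, Gamma x -> f (col_perm s x) = f x.

Definition concave_on Gamma f : Prop :=
  @convex_function R 'rV[R]_n Gamma (fun x => - f x).

Definition partial (i : 'I_n) f : 'rV[R]_n -> R :=
  fun x => 'D_(delta_mx 0 i) f x.

Definition iter_partial (s : seq 'I_n) f : 'rV[R]_n -> R := foldr partial f s.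

(* C^oo: the partial derivatives of all orders exist and are continuous. *)
Definition smooth_on Gamma f : Prop :=
  forall (s : seq 'I_n) x, Gamma x ->
    {for x, continuous (iter_partial s f)} /\
    forall i, derivable (iter_partial s f) x (delta_mx 0 i).

(* The limit of f (t x) as t -> +oo exists in [-oo, +oo] and is not -oo; for f
   concave on a convex cone, existence is automatic for x in the cone. *)
Definition ray_lim_gt_ninfty f x : Prop :=
  exists2 l : \bar R, (-oo < l)%E &
    (f (t *: x))%:E @[t --> +oo%R] --> l.

Definition Gamma_G Gamma f : set 'rV[R]_n :=
  [set x | Gamma x /\ ray_lim_gt_ninfty f x].

Definition zeros_ones (k : nat) : 'rV[R]_n :=
  \row_(i < n) (if (i < k)%N then 0 else 1).

Definition kappa (G : set 'rV[R]_n) : nat :=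
  \max_(k < n.+1 | `[< interior G (zeros_ones k) >]) k.

Definition sup_on Gamma f : \bar R := ereal_sup [set (f x)%:E | x in Gamma].

Definition sup_boundary Gamma f : \bar R :=
  ereal_sup [set limf_esup (fun x => (f x)%:E) (within Gamma (nbhs x0))
            | x0 in boundary Gamma].

Definition level_set Gamma f (sigma : R) : set 'rV[R]_n :=
  [set x | Gamma x /\ f x = sigma].

Definition below_sup Gamma f : set 'rV[R]_n :=
  [set x | Gamma x /\ ((f x)%:E < sup_on Gamma f)%E].

Definition uniformly_elliptic (m : nat) Gamma S f : Prop :=
  (forall x i, Gamma x -> 0 <= partial i f x) /\
  exists2 theta : R, 0 < theta &
    forall x, S x ->
      (forall i j : 'I_n, (i <= j)%N -> partial j f x <= partial i f x) ->
      forall i : 'I_n, (i < m)%N ->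
        0 < theta * (\sum_j partial j f x) <= partial i f x.

End Defs.

(* Main.v *)
Require Import Defs.
From HB Require Import structures.
From mathcomp Require Import all_boot all_order all_algebra all_fingroup.
From mathcomp Require Import all_classical all_reals all_analysis.
From mathcomp Require Import ring lra.

(** The gradient of a concave function is a supergradient: [f] lies below each
    of its tangent planes (concave_le_slope). Everything follows from this
    inequality, used in two opposite directions.

    Ellipticity. If [f] stays bounded below along the ray through [v], the
    tangent plane at any [x] in Gamma must stay above a constant along that
    ray, so the derivative of [f] at [x] in the direction [v] is nonnegative
    (slope_ge0). Thus the gradient of [f] lies in the dual cone of Gamma_G. For
    [v] in the positive orthant this gives [f_i >= 0], and swapping two
    coordinates shows that the partial derivatives are ordered oppositely to
    the coordinates (partial_antimono). By definition of kappa, Gamma_G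
    contains not only the vector with kappa zeros followed by ones but also
    its translate by [- c (1, ..., 1)] for some [c > 0]. Pairing it with the
    gradient bounds [c] times the sum of all [f_j] by the sum of the [f_j]
    with [j > kappa], hence by a multiple of each of the [1 + kappa] largest
    partial derivatives (ellipticity_constant); [c] is chosen from Gamma_G
    alone.

    Sharpness. Suppose that the [m] largest partial derivatives dominate a
    fixed fraction of their sum on the level set [f = sigma], and let [z] be
    the vector with [m - 1] zeros followed by ones. At least one of the [m]
    largest partial derivatives is paired with a one of [z] (perm_pigeonhole),
    so the derivative of [f] in every direction [v] close to [z] is positive
    on the level set. A ray in such a direction that starts in [f > sigma] can
    neither reach the level set again, by the tangent plane inequality, nor
    leave Gamma, because [f] is below [sigma] near the boundary
    (superlevel_ray). As [t v = x0 + t (v - x0 / t)], it follows that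
    [f (t v) > sigma] for large [t] and all [v] near [z]: so [z] is interior to
    Gamma_G and [m - 1 <= kappa] (elliptic_interior). *)

Import Order.TTheory GRing.Theory Num.Theory.
Import numFieldNormedType.Exports.

Local Open Scope classical_set_scope.
Local Open Scope ring_scope.

Set Implicit Arguments.
Unset Strict Implicit.
Unset Printing Implicit Defensive.

(** * Concavity with real coefficients *)

Lemma unit_interval_lift (R : realType) (t : R) :
  0 <= t <= 1 -> exists l : {i01 R}, l%:num = t.
Proof.
move=> /andP[t0 t1].
have ht : Itv.spec (@Itv.num_sem R) (Itv.Real `[0%Z, 1%Z]) t.
  by rewrite /Itv.spec/Itv.num_sem/= num_real/= in_itv/= t0 t1.
by exists (Itv.mk ht).
Qed.

Lemma convex_set_segment (R : realType) (n : nat) (D : set 'rV[R]_n)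
    (x y : 'rV[R]_n) (t : R) :
  convex_set D -> D x -> D y -> 0 <= t <= 1 ->
  D (t *: x + (1 - t) *: y).
Proof.
move=> cD Dx Dy /unit_interval_lift[l <-].
by have /set_mem := cD x y l (mem_set Dx) (mem_set Dy).
Qed.

Lemma concave_on_segment (R : realType) (n : nat) (D : set 'rV[R]_n)
    (f : 'rV[R]_n -> R) (x y : 'rV[R]_n) (t : R) :
  concave_on D f -> D x -> D y -> 0 <= t <= 1 ->
  t * f x + (1 - t) * f y <= f (t *: x + (1 - t) *: y).
Proof.
move=> cf Dx Dy /unit_interval_lift[l <-].
have := cf l x y (mem_set Dx) (mem_set Dy).
rewrite convRE/= /unstable.onem !mulrN -opprD lerN2; exact.
Qed.

(** Jensen's inequality for equal weights, by induction on the number of points: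
    the mean of [m + 2] points is the convex combination of the mean of the first
    [m + 1] and the last point, with weights [t] and [1 - t]. *)
Lemma concave_on_mean (R : realType) (n m : nat) (D : set 'rV[R]_n)
    (f : 'rV[R]_n -> R) (p : 'I_m.+1 -> 'rV[R]_n) :
  convex_set D -> concave_on D f -> (forall i, D (p i)) ->
  D (m.+1%:R^-1 *: \sum_i p i) /\
  m.+1%:R^-1 * (\sum_i f (p i)) <= f (m.+1%:R^-1 *: \sum_i p i).
Proof.
move=> cD cf; elim: m p => [|m IH] p Dp.
  by rewrite !big_ord_recr !big_ord0 /= !add0r invr1 scale1r mul1r.
have [Dq fq] := IH (fun i => p (widen_ord (leqnSn m.+1) i)) (fun i => Dp _).
rewrite !(big_ord_recr m.+1) /=.
set q := \sum_(i < m.+1) p _ in Dq fq *.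
set F := \sum_(i < m.+1) f _ in fq *.
pose t : R := m.+1%:R / m.+2%:R.
have t01 : 0 <= t <= 1.
  by rewrite divr_ge0 ?ler0n//= ler_pdivrMr ?ltr0n// mul1r ler_nat.
have t1 : 1 - t = m.+2%:R^-1.
  rewrite /t -[m.+2]addn1 natrD; field.
  by rewrite nat1r natr1 pnatr_eq0.
have e : m.+2%:R^-1 *: (q + p ord_max) =
    t *: (m.+1%:R^-1 *: q) + (1 - t) *: p ord_max.
  rewrite t1 scalerDr scalerA /t mulrAC divff ?mul1r// pnatr_eq0//.
rewrite e; split; first exact: convex_set_segment.
apply: le_trans (concave_on_segment cf Dq (Dp ord_max) t01).
rewrite t1 mulrDr lerD2r.
have -> : m.+2%:R^-1 * F = t * (m.+1%:R^-1 * F).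
  by rewrite mulrA; congr (_ * _); rewrite /t mulrAC divff ?mul1r// pnatr_eq0.
by rewrite ler_wpM2l//; case/andP: t01.
Qed.

(** * The gradient as a supergradient *)

Definition slope (R : realType) (n : nat) (f : 'rV[R]_n -> R)
  (x v : 'rV[R]_n) : R := \sum_i partial i f x * v 0 i.

Lemma slopeD (R : realType) (n : nat) (f : 'rV[R]_n -> R) (x u v : 'rV[R]_n) :
  slope f x (u + v) = slope f x u + slope f x v.
Proof. by rewrite -big_split/=; apply: eq_bigr => i _; rewrite mxE mulrDr. Qed.

Lemma slopeZ (R : realType) (n : nat) (f : 'rV[R]_n -> R) (x v : 'rV[R]_n)
  (a : R) : slope f x (a *: v) = a * slope f x v.
Proof. by rewrite mulr_sumr; apply: eq_bigr => i _; rewrite mxE mulrCA. Qed.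

Lemma slopeB (R : realType) (n : nat) (f : 'rV[R]_n -> R) (x u v : 'rV[R]_n) :
  slope f x (u - v) = slope f x u - slope f x v.
Proof. by rewrite slopeD -scaleN1r slopeZ mulN1r. Qed.

Lemma partial_approx (R : realType) (n : nat) (D : set 'rV[R]_n)
    (f : 'rV[R]_n -> R) (x : 'rV[R]_n) (e : R) :
  open D -> D x -> (forall i : 'I_n, derivable f x (delta_mx 0 i)) ->
  0 < e ->
  exists2 d : R, 0 < d & forall (i : 'I_n) (h : R), `|h| < d ->
    D (x + h *: delta_mx 0 i) /\
    `|f (x + h *: delta_mx 0 i) - f x - h * partial i f x| <= e * `|h|.
Proof.
move=> oD Dx df e0.
have N1 (i : 'I_n) : \forall h \near (0 : R), D (x + h *: delta_mx 0 i).
  have : (x + h *: (delta_mx 0 i : 'rV[R]_n)) @[h --> (0 : R)] --> x.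
    rewrite -[X in _ --> X]addr0.
    rewrite -[X in _ + X](scale0r (delta_mx 0 i : 'rV[R]_n)).
    by apply: cvgD; [exact: cvg_cst|apply: cvgZr_tmp; exact: cvg_id].
  by apply; exact: open_nbhs_nbhs.
have N2 (i : 'I_n) : \forall h \near (0 : R)^',
    `|partial i f x - h^-1 * (f (x + h *: delta_mx 0 i) - f x)| <= e.
  have /cvgr_dist_le/(_ e e0) := df i.
  by apply: filterS => h; rewrite /= [x + _]addrC.
have /nbhs_ballP[d1 /= d10 H1] : \forall h \near (0 : R),
    forall i : 'I_n, D (x + h *: delta_mx 0 i) by exact: filter_forall N1.
have /nbhs_ballP[d2 /= d20 H2] : nbhs (0 : R) (fun h => h != 0 ->
    forall i : 'I_n,
    `|partial i f x - h^-1 * (f (x + h *: delta_mx 0 i) - f x)| <= e).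
  exact: filter_forall N2.
exists (Num.min d1 d2); first by rewrite lt_min d10 d20.
move=> i h; rewrite lt_min => /andP[h1 h2].
split; first by apply: H1; rewrite /ball/= sub0r normrN.
have [->|h0] := eqVneq h 0.
  by rewrite scale0r addr0 subrr mul0r subr0 normr0 mulr0.
have := H2 h _ h0 i; rewrite /ball/= sub0r normrN => /(_ h2) H.
rewrite [leRHS]mulrC; apply: le_trans (ler_wpM2l (normr_ge0 h) H).
rewrite -normrM distrC.
by rewrite le_eqVlt; apply/orP; left; apply/eqP; congr `|_|; field.
Qed.

(** Only the partial derivatives at [x] enter, so no total differentiability has
    to be established first. With [v = y - x], concavity along the line through
    [x] and [y] bounds [f y - f x] by the forward quotient of [f] at [x], which
    is at most the backward quotient [(f x - f (x - t v)) / t]. Now [x - t v] is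
    the mean of points [p i] that differ from [x] in one coordinate each, so
    Jensen's inequality reduces the backward quotient to partial difference
    quotients, which converge. *)
Lemma concave_le_slope (R : realType) (n : nat) (D : set 'rV[R]_n)
    (f : 'rV[R]_n -> R) (x y : 'rV[R]_n) :
  open D -> convex_set D -> concave_on D f ->
  (forall i : 'I_n, derivable f x (delta_mx 0 i)) ->
  D x -> D y -> f y <= f x + slope f x (y - x).
Proof.
case: n D f x y => [|n] D f x y oD cD cf df Dx Dy.
  by rewrite (thinmx0 y) (thinmx0 x) /slope big_ord0 addr0.
set v := y - x; pose M : R := \sum_i `|v 0 i|.
have M0 : 0 <= M by apply: sumr_ge0.
have vM i : `|v 0 i| <= M by rewrite /M (bigD1 i)//= lerDl sumr_ge0.
apply/ler_addgt0Pr => e0 e00.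
pose e := e0 / (1 + M).
have e1 : 0 < e by rewrite divr_gt0// ltr_pwDl.
have [d d0 Hd] := partial_approx oD Dx df e1.
pose N : R := n.+1%:R.
have N0 : 0 < N by rewrite ltr0n.
(* This value satisfies both t <= 1 and N t M < d. *)
pose t := d / (d + N * M).
have dN : 0 < d + N * M by rewrite ltr_wpDr// mulr_ge0// ltW.
have t0 : 0 < t by rewrite divr_gt0.
have t01 : 0 <= t <= 1.
  by rewrite ltW//= ler_pdivrMr// mul1r lerDl mulr_ge0// ltW.
have tM : N * t * M < d.
  by rewrite /t mulrAC mulrA ltr_pdivrMr//; nra.
pose h i := - (N * t * v 0 i).
have hd i : `|h i| < d.
  rewrite /h normrN normrM (gtr0_norm (mulr_gt0 N0 t0)).
  by apply: le_lt_trans tM; rewrite ler_wpM2l// ltW// mulr_gt0.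
pose p i := x + h i *: delta_mx 0 i.
have Dp i : D (p i) by have [] := Hd i _ (hd i).
have [Dq fq] := concave_on_mean cD cf Dp.
have qE : N^-1 *: \sum_i p i = x - t *: v.
  rewrite big_split/= sumr_const card_ord scalerDr -scaler_nat scalerA.
  rewrite mulVf ?gt_eqF// scale1r; congr (_ + _).
  apply/rowP => j; rewrite !mxE summxE (bigD1 j)//= big1 ?addr0.
    by rewrite !mxE !eqxx mulr1 /h /v !mxE; field; rewrite gt_eqF.
  by move=> i ij; rewrite !mxE eqxx/= eq_sym (negbTE ij) mulr0.
rewrite -/N qE in Dq fq.
have A := concave_on_segment cf Dy Dx t01.
have DP := convex_set_segment cD Dy Dx t01.
have PE : t *: y + (1 - t) *: x = x + t *: v.
  by rewrite /v scalerBl scale1r scalerBr addrCA addrA.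
rewrite PE in A DP.
have h01 : 0 <= (2^-1 : R) <= 1 by lra.
have B := concave_on_segment cf DP Dq h01.
have hE : 2^-1 *: (x + t *: v) + (1 - 2^-1) *: (x - t *: v) = x.
  by apply/rowP => j; rewrite !mxE; lra.
rewrite hE in B.
have C : f x - N^-1 * \sum_i f (p i) <= t * (slope f x v + e * M).
  have -> : f x = N^-1 * \sum_(i < n.+1) f x.
    by rewrite sumr_const card_ord -[f x *+ _]mulr_natl mulKf// gt_eqF.
  rewrite -mulrBr -sumrB ler_pdivrMl// mulrA.
  rewrite /M mulr_sumr -big_split/= mulr_sumr; apply: ler_sum => i _.
  have [_] := Hd i _ (hd i); rewrite -/(p i) ler_norml => /andP[H _].
  have -> : f x - f (p i) =
    - (f (p i) - f x - h i * partial i f x) - h i * partial i f x by ring.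
  apply: (@le_trans _ _ (e * `|h i| - h i * partial i f x)).
    by rewrite lerD2r lerNl.
  rewrite /h normrN normrM (gtr0_norm (mulr_gt0 N0 t0)).
  by rewrite le_eqVlt; apply/orP; left; apply/eqP; ring.
have : t * (f y - f x) <= t * (slope f x v + e * M).
  apply: le_trans C; set P := f (x + _) in A B; set Q := f (x - _) in fq B.
  set F := N^-1 * _ in fq *; have {}A : t * (f y - f x) <= P - f x by lra.
  by apply: (le_trans A); lra.
rewrite ler_pM2l// => E.
have : e * M <= e0.
  by rewrite /e mulrAC ler_pdivrMr ?ltr_pwDl//; nra.
lra.
Qed.

(** * Rays along which the function is bounded below *)

Definition supergradient_on (R : realType) (n : nat) (Gamma : set 'rV[R]_n)
    (f : 'rV[R]_n -> R) : Prop :=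
  forall x y, Gamma x -> Gamma y -> f y <= f x + slope f x (y - x).

Definition bounded_below_on_ray (R : realType) (n : nat)
    (f : 'rV[R]_n -> R) (v : 'rV[R]_n) : Prop :=
  exists M t0 : R, forall t, t0 < t -> M <= f (t *: v).

Lemma ray_lim_bounded_below (R : realType) (n : nat) (f : 'rV[R]_n -> R)
    (v : 'rV[R]_n) :
  ray_lim_gt_ninfty f v -> bounded_below_on_ray f v.
Proof.
move=> [l l0 fl].
have [M lM] : exists M : R, nbhs l [set y | (M%:E < y)%E].
  case: l l0 {fl} => [r| |] // _.
    by exists (r - 1); apply: (@nbhs_open_ereal_gt _ _ (fun r => r - 1)); lra.
  by exists 0; exact: nbhs_open_ereal_pinfty.
have [t0 [_ H]] := fl _ lM.
by exists M, t0 => t /H /=; rewrite lte_fin => /ltW.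
Qed.

(** Along the ray through [v], [f] is squeezed between a constant and the affine
    function of [t] given by the tangent plane at [x], whose leading coefficient
    is [slope f x v]. *)
Lemma slope_ge0 (R : realType) (n : nat) (Gamma : set 'rV[R]_n)
    (f : 'rV[R]_n -> R) (x v : 'rV[R]_n) :
  (forall (t : R) x, 0 < t -> Gamma x -> Gamma (t *: x)) ->
  supergradient_on Gamma f -> Gamma x -> Gamma v ->
  bounded_below_on_ray f v -> 0 <= slope f x v.
Proof.
move=> scG sg Gx Gv [M [t0 Mf]]; rewrite leNgt; apply/negP => s0.
set s := slope f x v in s0.
(* Beyond t = c the tangent plane at x falls below M. *)
pose c := (f x - slope f x x - M) / - s.
pose t := `|t0| + 1 + `|c|.
have tp : 0 < t by rewrite /t; have := normr_ge0 t0; have := normr_ge0 c; lra.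
have tt : t0 < t by rewrite /t; have := ler_norm t0; have := normr_ge0 c; lra.
have tc : c < t by rewrite /t; have := normr_ge0 t0; have := ler_norm c; lra.
have := sg x (t *: v) Gx (scG _ _ tp Gv).
have := Mf t tt; rewrite slopeB slopeZ -/s => H1 H2.
move: tc; rewrite ltr_pdivrMr ?oppr_gt0// => H3.
lra.
Qed.

(** Since all slopes in the direction [v] are nonnegative, [f] is nondecreasing
    along the ray, so its limit exists and is the supremum. *)
Lemma bounded_below_ray_lim (R : realType) (n : nat) (Gamma : set 'rV[R]_n)
    (f : 'rV[R]_n -> R) (v : 'rV[R]_n) :
  (forall (t : R) x, 0 < t -> Gamma x -> Gamma (t *: x)) ->
  supergradient_on Gamma f -> Gamma v ->
  bounded_below_on_ray f v -> ray_lim_gt_ninfty f v.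
Proof.
move=> scG sg Gv bv.
(* Freezing f (t v) for t <= 1 makes the function monotone on the whole line. *)
pose g (t : R) : \bar R := (f (Num.max t 1 *: v))%:E.
have g_mono : {homo g : a b / (a <= b)%R >-> (a <= b)%E}.
  move=> a b ab; rewrite lee_fin.
  set a' := Num.max a 1; set b' := Num.max b 1.
  have a0 : 0 < a' by rewrite lt_max ltr01 orbT.
  have b0 : 0 < b' by rewrite lt_max ltr01 orbT.
  have ab' : a' <= b' by rewrite ge_max !le_max ab lexx orbT.
  have := sg (b' *: v) (a' *: v) (scG _ _ b0 Gv) (scG _ _ a0 Gv).
  rewrite -scalerBl slopeZ.
  have := slope_ge0 scG sg (scG _ _ b0 Gv) Gv bv.
  by nra.
have gl := nondecreasing_cvge g_mono.
exists (ereal_sup (range g)).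
  apply: (@lt_le_trans _ _ (g 1)); first by rewrite ltNyr.
  by apply: ereal_sup_ubound; exists 1.
have gE : \forall t \near +oo, g t = (f (t *: v))%:E.
  exists 1; split; first exact: (@num_real R 1).
  by move=> t /= t1; rewrite /g max_l// ltW.
exact: cvg_trans (near_eq_cvg gE) gl.
Qed.

(** * Sign and ordering of the partial derivatives *)

(** The coordinate vector [e_i] is only a limit of positive vectors
    [e_i + a (1, ..., 1)], hence the passage to the limit in [a]. *)
Lemma partial_ge0 (R : realType) (n : nat)
    (f : 'rV[R]_n -> R) (x : 'rV[R]_n) (i : 'I_n) :
  (forall v, @Gamma_pos R n v -> 0 <= slope f x v) ->
  0 <= partial i f x.
Proof.
move=> sl; apply/ler_addgt0Pl => e e0.
pose T := \sum_j partial j f x.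
pose a := e / (1 + `|T|).
have a0 : 0 < a by rewrite divr_gt0// ltr_pwDl.
have := sl (delta_mx 0 i + a *: const_mx 1).
have -> : slope f x (delta_mx 0 i + a *: const_mx 1) = partial i f x + a * T.
  rewrite slopeD slopeZ; congr (_ + _ * _).
    rewrite /slope (bigD1 i)//= big1 ?addr0 ?mxE ?eqxx ?mulr1// => j ji.
    by rewrite mxE eqxx (negbTE ji) mulr0.
  by apply: eq_bigr => j _; rewrite mxE mulr1.
move=> H; apply: (@le_trans _ _ (partial i f x + a * T)).
  apply: H => j; rewrite !mxE mulr1 ltr_wpDl// ler0n//.
rewrite addrC lerD2r; apply: (@le_trans _ _ (a * `|T|)).
  by rewrite ler_wpM2l// ?ler_norm// ltW.
by rewrite /a mulrAC ler_pdivrMr ?ltr_pwDl//; have := normr_ge0 T; nra.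
Qed.

Lemma sum_partial_gt0 (R : realType) (n : nat) (Gamma : set 'rV[R]_n)
    (f : 'rV[R]_n -> R) (x y : 'rV[R]_n) :
  supergradient_on Gamma f -> Gamma x -> Gamma y -> f x < f y ->
  (forall i : 'I_n, 0 <= partial i f x) ->
  0 < \sum_i partial i f x.
Proof.
move=> sg Gx Gy xy d0; rewrite lt_neqAle sumr_ge0// andbT eq_sym.
apply/negP => /eqP /psumr_eq0P s0.
have := sg x y Gx Gy; rewrite /slope big1 ?addr0 ?leNgt ?xy//.
by move=> i _; rewrite s0 ?mul0r.
Qed.

Lemma partial_col_perm (R : realType) (n : nat) (Gamma : set 'rV[R]_n)
    (f : 'rV[R]_n -> R) (x : 'rV[R]_n) (s : 'S_n) (i : 'I_n) :
  open Gamma -> symmetric_on Gamma f -> Gamma x ->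
  partial i f (col_perm s x) = partial (s i) f x.
Proof.
move=> oG sf Gx; rewrite /partial.
have -> : 'D_(delta_mx 0 (s i)) f x =
          'D_(delta_mx 0 (s i)) (f \o col_perm s) x.
  apply: near_eq_derive; have : nbhs x Gamma by exact: open_nbhs_nbhs.
  by apply: filterS => y Gy; rewrite /= sf.
rewrite /derive.
suff -> : (fun h : R => h^-1 *: ((f \o shift (col_perm s x))
      (h *: delta_mx 0 i) - f (col_perm s x))) =
    (fun h : R => h^-1 *: ((f \o col_perm s \o shift x)
      (h *: delta_mx 0 (s i)) - (f \o col_perm s) x)) by [].
apply/funext => h /=; congr (_ *: (f _ - _)).
by apply/rowP => j; rewrite !mxE (inj_eq perm_inj).
Qed.

(** Exchanging two coordinates of [x] does not change [f], so the tangent plane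
    inequality reads [0 <= (f_i - f_j) (x_j - x_i)]; when [x_i = x_j] the two
    partial derivatives agree by symmetry. *)
Lemma partial_antimono (R : realType) (n : nat) (Gamma : set 'rV[R]_n)
    (f : 'rV[R]_n -> R) (x : 'rV[R]_n) (i j : 'I_n) :
  open Gamma -> symmetric_set Gamma -> symmetric_on Gamma f ->
  supergradient_on Gamma f -> Gamma x ->
  x 0 i <= x 0 j -> partial j f x <= partial i f x.
Proof.
move=> oG sG sf sg Gx.
have [->//|ij] := eqVneq i j.
rewrite le_eqVlt => /orP[/eqP xij|xij].
  have -> : partial j f x = partial (tperm i j i) f x by rewrite tpermL.
  rewrite -(partial_col_perm _ _ oG sf Gx) le_eqVlt; apply/orP; left.
  apply/eqP; congr (partial i f _); apply/rowP => k; rewrite mxE.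
  by case: tpermP => [->|->|].
have := sg x (col_perm (tperm i j) x) Gx (sG _ _ Gx).
rewrite sf// lerDl /slope (bigD1 i)//= (bigD1 j)//=; last by rewrite eq_sym.
rewrite big1 ?addr0 => [|k /andP[ki kj]]; last first.
  by rewrite !mxE tpermD ?subrr ?mulr0// eq_sym.
rewrite !mxE tpermL tpermR => H.
have : 0 <= (partial i f x - partial j f x) * (x 0 j - x 0 i).
  by apply: le_trans H _; rewrite le_eqVlt; apply/orP; left; apply/eqP; ring.
by rewrite pmulr_lge0 ?subr_gt0// subr_ge0.
Qed.

(** * The ellipticity constant *)

Lemma nbhs_rowP (R : realType) (n : nat) (x : 'rV[R]_n) (A : set 'rV[R]_n) :
  nbhs x A <->
  exists2 d : R, 0 < d & forall y : 'rV[R]_n,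
    (forall i, `|y 0 i - x 0 i| < d) -> A y.
Proof.
split=> [/nbhs_ballP[d /= d0 H]|[d d0 H]].
  exists d => // y xy; apply: H; split=> // i j.
  by rewrite ord1 /ball/= distrC; exact: xy.
apply/nbhs_ballP; exists d => //= y [_ xy]; apply: H => i.
by have := xy 0 i; rewrite /ball/= distrC.
Qed.

(** The maximum defining kappa is attained as soon as its index set is
    nonempty; the value of an empty maximum would be 0. *)
Lemma kappa_interior (R : realType) (n : nat) (G : set 'rV[R]_n) :
  interior G (zeros_ones R n 0) -> interior G (zeros_ones R n (kappa G)).
Proof.
move=> G0.
pose P := [pred k : 'I_n.+1 | `[< interior G (zeros_ones R n k) >]].
have P0 : (0 < #|P|)%N.
  by apply/card_gt0P; exists ord0; rewrite inE.
have [k /asboolP Gk kE] := eq_bigmax_cond (@nat_of_ord n.+1) P0.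
by have -> : kappa G = k by [].
Qed.

Lemma leq_kappa (R : realType) (n k : nat) (G : set 'rV[R]_n) :
  (k <= n)%N -> interior G (zeros_ones R n k) -> (k <= kappa G)%N.
Proof.
rewrite -ltnS => kn Gk; rewrite /kappa.
by apply: (@leq_bigmax_cond _ _ (@nat_of_ord n.+1) (Ordinal kn)); apply/asboolP.
Qed.

(** The vector [g] stands for a gradient. The constant is quantified before [g]
    and depends on [G] alone, which is what makes it uniform over all functions
    with the same set [G]. *)
Lemma ellipticity_constant (R : realType) (n k : nat) (G : set 'rV[R]_n) :
  exists2 theta : R, 0 < theta & interior G (zeros_ones R n k) ->
    forall g : 'I_n -> R, (forall i, 0 <= g i) ->
    (forall i j : 'I_n, (i <= j)%N -> g j <= g i) ->
    (forall v, G v -> 0 <= \sum_i g i * v 0 i) ->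
    forall i : 'I_n, (i <= k)%N -> theta * \sum_j g j <= g i.
Proof.
have [Gz|nGz] := pselect (interior G (zeros_ones R n k)); last by exists 1.
have /nbhs_rowP[d d0 H] := Gz.
pose c := d / 2; have c0 : 0 < c by rewrite divr_gt0.
(* There are at most n indices j >= k; n.+1 keeps the constant positive when
   n = 0. *)
exists (c / n.+1%:R) => [|_ g g0 gmono gG i ik]; first by rewrite divr_gt0// ltr0n.
have : G (zeros_ones R n k - const_mx c).
  apply: H => j; rewrite !mxE addrAC subrr sub0r normrN gtr0_norm//.
  by rewrite /c ltr_pdivrMr// ltr_pMr// ltr1n.
move=> /gG.
have -> : \sum_j g j * (zeros_ones R n k - const_mx c) 0 j =
   \sum_(j < n | (k <= j)%N) g j - c * \sum_j g j.
  rewrite mulr_sumr [X in _ = X - _]big_mkcond -sumrB; apply: eq_bigr => j _.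
  by rewrite !mxE ltnNge; case: (k <= j)%N => /=; ring.
rewrite subr_ge0 => /le_trans le1.
rewrite mulrAC ler_pdivrMr ?ltr0n//; apply: le1.
apply: (@le_trans _ _ (\sum_(j < n) g i)).
  rewrite big_mkcond; apply: ler_sum => j _.
  by case: ifPn => // kj; apply: gmono; exact: leq_trans kj.
by rewrite sumr_const card_ord -[g i *+ _]mulr_natr ler_wpM2l// ler_nat.
Qed.

(** * Sharpness *)

Lemma sup_boundary_lt (R : realType) (n : nat) (Gamma : set 'rV[R]_n)
    (f : 'rV[R]_n -> R) (sigma : R) (p : 'rV[R]_n) :
  (sup_boundary Gamma f < sigma%:E)%E -> boundary Gamma p ->
  \forall x \near p, Gamma x -> f x < sigma.
Proof.
move=> supf bp.
have : (limf_esup (fun x => (f x)%:E) (within Gamma (nbhs p)) < sigma%:E)%E.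
  by apply: le_lt_trans supf; apply: ereal_sup_ubound; exists p.
rewrite limf_esupE => /ereal_inf_lt[_ [V VF <-] Vs].
have {}VF : nbhs p (fun x => Gamma x -> V x) by exact: VF.
apply: filterS VF => x Vx Gx.
rewrite -lte_fin; apply: le_lt_trans Vs.
by apply: ereal_sup_ubound; exists x => //; exact: Vx.
Qed.

(** Let [T] be the first time at which the ray leaves the superlevel set, and [p]
    the exit point. If [p] is in Gamma then [f p = sigma], and the tangent plane
    at [p] gives [f x0 <= sigma - T * slope f p v < sigma], a contradiction. If
    [p] is not in Gamma, it is a boundary point, near which [f < sigma], although
    the ray comes arbitrarily close to [p] with [f > sigma]. *)
Lemma superlevel_ray (R : realType) (n : nat) (Gamma : set 'rV[R]_n)
    (f : 'rV[R]_n -> R) (sigma : R) (x0 v : 'rV[R]_n) :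
  open Gamma -> (forall x, Gamma x -> {for x, continuous f}) ->
  supergradient_on Gamma f ->
  (sup_boundary Gamma f < sigma%:E)%E ->
  Gamma x0 -> sigma < f x0 ->
  (forall p, level_set Gamma f sigma p -> 0 < slope f p v) ->
  forall t, 0 <= t -> Gamma (x0 + t *: v) /\ sigma < f (x0 + t *: v).
Proof.
move=> oG fc sg supf Gx0 fx0 sl.
pose good t := Gamma (x0 + t *: v) /\ sigma < f (x0 + t *: v).
have good0 : good 0 by rewrite /good scale0r addr0.
move=> t1 t10; apply: contrapT => bad.
pose E := [set t | 0 <= t /\ ~ good t].
have hE : has_inf E.
  by split; [exists t1|exists 0 => t []].
pose T := inf E; pose p := x0 + T *: v.
have T0 : 0 <= T by apply: lb_le_inf; [case: hE|move=> t []].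
have ltT t : 0 <= t -> t < T -> good t.
  move=> t0 tT; apply: contrapT => nt; move: tT; rewrite ltNge => /negP; apply.
  by apply: ge_inf; [case: hE|split].
have linec : (x0 + t *: v) @[t --> T] --> p.
  by apply: cvgD; [exact: cvg_cst|apply: cvgZr_tmp; exact: cvg_id].
have nearT (A : set 'rV[R]_n) : nbhs p A ->
    exists2 d, 0 < d & forall t, `|t - T| < d -> A (x0 + t *: v).
  move=> /linec /nbhs_ballP[d /= d0 H]; exists d => // t td.
  by apply: H; rewrite /ball/= distrC.
have goodnear : Gamma p -> sigma < f p ->
    \forall x \near p, Gamma x /\ sigma < f x.
  move=> Gp fp; apply: filterI; first exact: open_nbhs_nbhs.
  exact: (cvgr_gt _ (fc p Gp)).
have ngood : ~ good T.
  move=> [Gp fp]; have [d d0 H] := nearT _ (goodnear Gp fp).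
  have [t [t0 nt] tT] := inf_adherent d0 hE.
  have Tt : T <= t by apply: ge_inf; [case: hE|split].
  apply: nt; apply: H.
  by rewrite ger0_norm ?subr_ge0// ltrBlDl.
have Tp : 0 < T.
  by rewrite lt_neqAle T0 andbT; apply/eqP => T0'; apply: ngood; rewrite -T0'.
have left_pt (A : set 'rV[R]_n) : nbhs p A -> exists2 t, good t & A (x0 + t *: v).
  move=> /nearT[d d0 H].
  pose e := Num.min T (d / 2).
  have e0 : 0 < e by rewrite lt_min Tp divr_gt0.
  have eT : e <= T by rewrite ge_min lexx.
  have ed : e < d.
    by rewrite gt_min; apply/orP; right; rewrite ltr_pdivrMr// ltr_pMr// ltr1n.
  exists (T - e); first by apply: ltT; lra.
  by apply: H; rewrite addrAC subrr sub0r normrN gtr0_norm.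
have [Gp|nGp] := pselect (Gamma p).
  have fle : f p <= sigma.
    by rewrite leNgt; apply/negP => fp; apply: ngood; split.
  have fge : sigma <= f p.
    rewrite leNgt; apply/negP => fp.
    have /left_pt[t [_ st]] : nbhs p [set x | f x < sigma].
      exact: (cvgr_lt _ (fc p Gp)).
    by rewrite /= ltNge ltW.
  have lp : level_set Gamma f sigma p.
    by split => //; apply/eqP; rewrite eq_le fle fge.
  have := sg p x0 Gp Gx0; have := sl p lp.
  have -> : x0 - p = - T *: v by rewrite scaleNr /p opprD addNKr.
  by rewrite slopeZ; nra.
have bp : boundary Gamma p.
  split; last by move=> /interior_subset.
  by move=> A /left_pt[t [Gt _] At]; exists (x0 + t *: v); split.
have [t [Gt st] At] := left_pt _ (sup_boundary_lt supf bp).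
by have := At Gt; rewrite ltNge ltW.
Qed.

Lemma sort_row (R : realType) (n : nat) (x : 'rV[R]_n) :
  exists s : 'S_n, forall i j : 'I_n, (i <= j)%N -> x 0 (s i) <= x 0 (s j).
Proof.
pose t := [tuple x 0 i | i < n].
have st : size (sort <=%R t) = n by rewrite size_sort size_tuple.
have /tuple_permP[s sE] : perm_eq (sort <=%R t) t by rewrite perm_sort.
exists s => i j ij.
have nthE (k : 'I_n) : nth 0 (sort <=%R t) k = x 0 (s k).
  by rewrite sE -tnth_nth !tnth_mktuple.
rewrite -!nthE; apply: (sorted_leq_nth le_trans lexx) => //.
- exact: sort_le_sorted.
- by rewrite inE st.
- by rewrite inE st.
Qed.

(** A permutation cannot map the first [m] indices into the first [m - 1]. *)
Lemma perm_pigeonhole (n m : nat) (s : 'S_n) : (0 < m <= n)%N ->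
  exists2 i : 'I_n, (i < m)%N & (m.-1 <= s i)%N.
Proof.
move=> /andP[m0 mn]; apply: contrapT => H.
have slt (i : 'I_m) : (s (widen_ord mn i) < m.-1)%N.
  by rewrite ltnNge; apply/negP => h; apply: H; exists (widen_ord mn i) => /=.
have inj : injective (fun i : 'I_m => Ordinal (slt i)).
  move=> i j /(congr1 val)/= /val_inj/perm_inj/(congr1 val)/= ij.
  exact: val_inj.
have := leq_card _ inj; rewrite !card_ord.
by case: m m0 {mn slt inj H} => // m _; rewrite ltnn.
Qed.

(** Ellipticity is assumed only at points whose partial derivatives are sorted;
    the symmetry of [f] and [S] carries it over to all points of the level set
    by sorting their coordinates. *)
Lemma elliptic_interior (R : realType) (n m : nat) (Gamma S : set 'rV[R]_n)
    (f : 'rV[R]_n -> R) (sigma : R) :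
  open Gamma -> symmetric_set Gamma ->
  (forall (t : R) x, 0 < t -> Gamma x -> Gamma (t *: x)) ->
  (forall x, Gamma x -> {for x, continuous f}) ->
  symmetric_on Gamma f -> supergradient_on Gamma f -> symmetric_set S ->
  (sup_boundary Gamma f < sigma%:E < sup_on Gamma f)%E ->
  level_set Gamma f sigma `<=` S ->
  (0 < m <= n)%N -> uniformly_elliptic m Gamma S f ->
  interior (Gamma_G Gamma f) (zeros_ones R n m.-1).
Proof.
move=> oG sG scG fc sf sg sS /andP[supf sigf] lS mn [d0 [theta theta0 ell]].
have [_ [x0 Gx0 <-]] := ereal_sup_gt sigf; rewrite lte_fin => fx0.
(* Half of theta absorbs the perturbation of the direction. *)
pose d := theta / 2; have dp : 0 < d by rewrite divr_gt0.
have sl (v : 'rV[R]_n) : (forall i, `|v 0 i - zeros_ones R n m.-1 0 i| <= d) ->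
    forall p, level_set Gamma f sigma p -> 0 < slope f p v.
  move=> vz p lp; have [Gp _] := lp.
  have [s sp] := sort_row p.
  have [i im si] := perm_pigeonhole s mn.
  pose q := col_perm s p.
  have pq k : partial k f q = partial (s k) f p by exact: partial_col_perm oG sf Gp.
  have sumq : \sum_k partial k f q = \sum_k partial k f p.
    by rewrite [RHS](reindex_inj (@perm_inj _ s)); apply: eq_bigr => k _.
  have := ell q (sS _ _ (lS _ lp)) _ i im; rewrite sumq pq => /(_ _)/andP[].
    move=> j k jk; rewrite !pq.
    by apply: (partial_antimono oG sG sf sg Gp); exact: sp.
  rewrite pmulr_rgt0// => D0 Dle.
  apply: (@lt_le_trans _ _ (partial (s i) f p - d * \sum_k partial k f p)).
    by rewrite subr_gt0; apply: lt_le_trans Dle; rewrite ltr_pM2r// /d; lra.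
  rewrite mulr_sumr (bigD1 (s i))//= opprD addrA.
  rewrite /slope [leRHS](bigD1 (s i))//= lerD//.
    have := vz (s i); rewrite mxE ltnNge si/= ler_norml => /andP[h _].
    by have := d0 p (s i) Gp; nra.
  rewrite -sumrN; apply: ler_sum => k _.
  have := vz k; rewrite mxE ler_norml => /andP[h _].
  by have := d0 p k Gp; move: h; case: ifP => _; nra.
pose N := \sum_i `|x0 0 i|.
have N0 : 0 <= N by apply: sumr_ge0.
have d2 : 0 < d / 2 by rewrite divr_gt0.
(* Beyond t1, the shift x0 / t costs at most the remaining half of d. *)
have [t1 t10 t1N] : exists2 t1 : R, 0 < t1 & forall t, t1 < t -> N <= t * (d / 2).
  exists ((N + 1) / (d / 2)); first by rewrite divr_gt0// ltr_wpDl.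
  by move=> t; rewrite ltr_pdivrMr//; lra.
have far (w : 'rV[R]_n) : (forall i, `|w 0 i - zeros_ones R n m.-1 0 i| < d / 2) ->
    forall t, t1 < t -> Gamma (t *: w) /\ sigma < f (t *: w).
  move=> wz t tt1; have t0 : 0 < t by exact: lt_trans tt1.
  have -> : t *: w = x0 + t *: (w - t^-1 *: x0).
    by rewrite scalerBr scalerA divff ?gt_eqF// scale1r addrC subrK.
  apply: (superlevel_ray oG fc sg supf Gx0 fx0) => [|]; last exact: ltW.
  apply: sl => i; rewrite !mxE.
  have xd : `|t^-1 * x0 0 i| <= d / 2.
    rewrite normrM gtr0_norm ?invr_gt0// ler_pdivrMl//.
    apply: le_trans (t1N _ tt1).
    by rewrite /N (bigD1 i)//= lerDl sumr_ge0.
  have := wz i; rewrite mxE => wd.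
  rewrite addrAC; apply: le_trans (ler_normB _ _) _; lra.
apply/nbhs_rowP; exists (d / 2) => // w wz.
have t1t : t1 < t1 + 1 by lra.
have Gw : Gamma w.
  have [G1 _] := far w wz _ t1t.
  have -> : w = (t1 + 1)^-1 *: ((t1 + 1) *: w).
    by rewrite scalerA mulVf ?scale1r// gt_eqF//; lra.
  by apply: scG => //; rewrite invr_gt0; lra.
split => //; apply: (bounded_below_ray_lim scG sg Gw).
by exists sigma, t1 => t /(far w wz)[_ /ltW].
Qed.

Unset Implicit Arguments.

(** * Uniform ellipticity and its optimality *)

Theorem theorem5p6 (R : realType) (n : nat) :
  exists theta : set 'rV[R]_n -> R,
  forall (Gamma : set 'rV[R]_n) (f : 'rV[R]_n -> R)
         (S : set 'rV[R]_n) (sigma : R),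
    admissible_cone Gamma ->
    smooth_on Gamma f ->
    symmetric_on Gamma f ->
    concave_on Gamma f ->
    (forall x, Gamma_pos x -> ray_lim_gt_ninfty f x) ->
    symmetric_set S ->
    S `<=` below_sup Gamma f ->
    (sup_boundary Gamma f < sigma%:E < sup_on Gamma f)%E ->
    level_set Gamma f sigma `<=` S ->
    [/\ (forall x (i : 'I_n), Gamma x -> 0 <= partial i f x),
        0 < theta (Gamma_G Gamma f),
        (forall x, S x ->
           (forall i j : 'I_n, (i <= j)%N -> x 0 i <= x 0 j) ->
           forall i : 'I_n, (i < 1 + kappa (Gamma_G Gamma f))%N ->
             0 < theta (Gamma_G Gamma f) * (\sum_j partial j f x)
               <= partial i f x)
      & (forall m : nat, (1 <= m <= n)%N ->
           uniformly_elliptic m Gamma S f ->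
           (m <= 1 + kappa (Gamma_G Gamma f))%N)].
Proof.
pose th (G : set 'rV[R]_n) := cid2 (ellipticity_constant (kappa G) G).
exists (fun G => s2val (th G)) => Gamma f S sigma [oG cG scG sG _ _ posG] smf sf cf.
move=> rayf sS Sbelow sigmaP lS.
have fc x : Gamma x -> {for x, continuous f} by move=> /(smf [::])[].
have sg : supergradient_on Gamma f.
  move=> x y Gx Gy; apply: (concave_le_slope oG cG cf _ Gx Gy) => i.
  by have [_ +] := smf [::] x Gx; apply.
have sl0 x v : Gamma x -> Gamma_G Gamma f v -> 0 <= slope f x v.
  by move=> Gx [Gv /ray_lim_bounded_below]; exact: slope_ge0 scG sg Gx Gv.
have posGG : @Gamma_pos R n `<=` Gamma_G Gamma f.
  by move=> v v0; split; [exact: posG|exact: rayf].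
have d0 x (i : 'I_n) : Gamma x -> 0 <= partial i f x.
  by move=> Gx; apply: partial_ge0 => v /posGG; exact: sl0.
split=> //; first by case: (th _).
  move=> x Sx xmono i; rewrite add1n ltnS => ik.
  have [Gx fx] := Sbelow x Sx.
  have [_ [y Gy <-]] := ereal_sup_gt fx; rewrite lte_fin => xy.
  case: (th _) => c c0 H /=; apply/andP; split.
    by rewrite mulr_gt0//; apply: (sum_partial_gt0 sg Gx Gy xy) => j; exact: d0.
  apply: H => //.
  - apply: kappa_interior; apply/nbhs_rowP; exists 1 => // y1 H; apply: posGG => j.
    by have := H j; rewrite mxE/= ltr_norml; lra.
  - by move=> j; exact: d0.
  - by move=> j k jk; apply: (partial_antimono oG sG sf sg Gx); exact: xmono.
  - by move=> v; exact: sl0.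
move=> m mn ell; have [m0 mn'] := andP mn.
rewrite -(prednK m0) add1n ltnS; apply: leq_kappa.
  by apply: leq_trans mn'; exact: leq_pred.
exact: (elliptic_interior oG sG scG fc sf sg sS sigmaP lS mn ell).
Qed.
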